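(* Let $X$ be a real Banach space with dual $X^{\ast}$ and let $T:X\rightrightarrows X^{\ast}$ be a set-valued operator. There exists a lower semicontinuous proper convex functional $f:X\rightarrow\mathbb{R}\cup\{+\infty\}$ such that $T=\partial f$ if and only if $T$ is maximally monotone and there exists a monotone operator $A:X\times\mathbb{R}\rightrightarrows X^{\ast}\times\mathbb{R}$ such that $T=A_{X}$ and the following three conditions hold: (i) $\mathrm{barr}\left(\mathrm{cl}\,\mathrm{conv}\,\mathrm{dom}\,A\right)\cap\left(X^{\ast}\times\{-1\}\right)\neq\emptyset$; (ii) $\left(0_{X},1\right)\in 0^{+}\left(\mathrm{cl}\,\mathrm{conv}\,\mathrm{dom}\,A\right)$; (iii) $\left(0_{X^{\ast}},0\right)\in\bigcap_{(x,\lambda)\in \mathrm{dom}\,A}A(x,\lambda)$.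
   Context: Let $\langle x,x^{\ast}\rangle$ denote the value of $x^{\ast}\in X^{\ast}$ at $x\in X$. Operators are identified with their graphs: $(x,x^{\ast})\in T$ means $x^{\ast}\in T(x)$. The Fenchel subdifferential operator $\partial f:X\rightrightarrows X^{\ast}$ of $f:X\to\mathbb{R}\cup\{+\infty\}$ is $\partial f(x):=\{x^{\ast}\in X^{\ast}: f(y)\geq f(x)+\langle y-x,x^{\ast}\rangle\ \forall y\in X\}$. A functional with values in $\mathbb{R}\cup\{+\infty\}$ is proper if it is not identically $+\infty$. For a real Banach space $Z$, an operator $S:Z\rightrightarrows Z^{\ast}$ is monotone if $\langle z_0-z_1,z_0^{\ast}-z_1^{\ast}\rangle\geq 0$ for all $(z_0,z_0^{\ast}),(z_1,z_1^{\ast})\in S$; it is maximally monotone if it is monotone and not properly contained in any other monotone operator. Its domain is $\mathrm{dom}\,S:=\{z\in Z:S(z)\neq\emptyset\}$. For $C\subseteq Z$, $\mathrm{cl}\,C$ and $\mathrm{conv}\,C$ are the (norm) closure and the convex hull of $C$; the barrier cone is $\mathrm{barr}(C):=\{z^{\ast}\in Z^{\ast}:\sup_{z\in C}\langle z,z^{\ast}\rangle<+\infty\}$; the recession cone is $0^{+}(C):=\{d\in Z: C+\mathbb{R}_{+}d=C\}$, where $\mathbb{R}_{+}=[0,+\infty)$. These notions are applied to $Z=X$ and to $Z=X\times\mathbb{R}$, whose dual is identified with $X^{\ast}\times\mathbb{R}$ via $\langle(x,\lambda),(x^{\ast},\mu)\rangle=\langle x,x^{\ast}\rangle+\lambda\mu$.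 The zero elements of $X$ and $X^{\ast}$ are $0_X$ and $0_{X^{\ast}}$. To an operator $A:X\times\mathbb{R}\rightrightarrows X^{\ast}\times\mathbb{R}$ one associates the operator $A_X:X\rightrightarrows X^{\ast}$ defined by $$A_{X}(x):=\Pi_{X^{\ast}}\left(\left(\bigcup_{\lambda\in\mathbb{R}}A(x,\lambda)\right)\cap\left(X^{\ast}\times\{-1\}\right)\right),$$ where $\Pi_{X^{\ast}}$ is the projection of $X^{\ast}\times\mathbb{R}$ onto $X^{\ast}$; that is, $x^{\ast}\in A_X(x)$ if and only if $(x^{\ast},-1)\in A(x,\lambda)$ for some $\lambda\in\mathbb{R}$. *)

(* Defs.v *)
From HB Require Import structures.
From mathcomp Require Import all_boot all_order all_algebra.
From mathcomp Require Import all_classical all_reals all_analysis.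

Set Implicit Arguments.
Unset Strict Implicit.
Unset Printing Implicit Defensive.

Import Order.TTheory GRing.Theory Num.Theory.
Import numFieldNormedType.Exports.

Local Open Scope classical_set_scope.
Local Open Scope ring_scope.

(* The topological dual of [X] is a subspace of the functions [X -> R^o]. *)
Section dual.
Context {R : realType} {X : normedModType R}.

Definition continuous_linear : {pred X -> R^o} :=
  fun f => `[< linear f /\ continuous f >].

Lemma continuous_linear_submod_closed : submod_closed continuous_linear.
Proof.
split=> [|a f g /asboolP[lf cf] /asboolP[lg cg]].
- apply/asboolP; split=> [b u v|]; first by rewrite scaler0 addr0.
  exact: cst_continuous.
- apply/asboolP; split=> [b u v|x].
    rewrite -[LHS]/(a *: f (b *: u + v) + g (b *: u + v)).
    rewrite -[RHS]/(b *: (a *: f u + g u) + (a *: f v + g v)).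
    rewrite lf lg !scalerDr !scalerA mulrC !addrA; congr (_ + _).
    by rewrite addrAC.
  apply: (@continuousD R R^o X (fun y => a *: f y) g) => //; last exact: cg.
  by apply: (@continuousZl_tmp _ _ _ f a); exact: cf.
Qed.

HB.instance Definition _ := GRing.isSubmodClosed.Build R (X -> R^o)
  continuous_linear continuous_linear_submod_closed.

End dual.

Record dual {R : realType} (X : normedModType R) := Dual {
  dual_fun :> X -> R^o ;
  dual_funP : dual_fun \in continuous_linear }.

Section dual_lmod.
Context {R : realType} {X : normedModType R}.
HB.instance Definition _ := [isSub for @dual_fun R X].
HB.instance Definition _ := [Choice of dual X by <:].
HB.instance Definition _ := [SubChoice_isSubLmodule of dual X by <:].
End dual_lmod.

(* In an operator [S : Z -> set Zs], the set [S z] is the value of [S] at [z].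
   The notions below are relative to a duality pairing [p], so that they apply
   to [X] and to [X * R^o]. *)
Section operators.
Context {R : realType} {Z : normedModType R} {Zs : zmodType}.
Variable p : Z -> Zs -> R.

Definition monotone_op (S : Z -> set Zs) :=
  forall z0 z1 z0s z1s, S z0 z0s -> S z1 z1s -> 0 <= p (z0 - z1) (z0s - z1s).

Definition maximally_monotone_op (S : Z -> set Zs) :=
  monotone_op S /\
  forall S', monotone_op S' -> (forall z, S z `<=` S' z) -> S' = S.

Definition op_dom (S : Z -> set Zs) : set Z := [set z | S z !=set0].

Definition barr (C : set Z) : set Zs :=
  [set zs | (ereal_sup [set (p z zs)%:E | z in C] < +oo)%E].

End operators.

Section sets.
Context {R : realType} {Z : normedModType R}.

Definition conv_hull (C : set Z) : set Z := smallest (@convex_set R Z) C.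

Definition recession_cone (C : set Z) : set Z :=
  [set d | [set c + t *: d | c in C & t in `[0, +oo[%classic] = C].

End sets.

Section banach.
Context {R : realType} {X : normedModType R}.

Definition pairing (x : X) (xs : dual X) : R := xs x.

Definition prod_pairing (z : X * R^o) (zs : dual X * R) : R :=
  pairing z.1 zs.1 + z.2 * zs.2.

Definition convex_efun (f : X -> \bar R) :=
  forall (x y : X) (t : R), 0 < t < 1 ->
    (f (t *: x + (1 - t) *: y)%R <= t%:E * f x + (1 - t)%:E * f y)%E.

(* Meant for [f] with values in [R] or [+oo]. *)
Definition proper_efun (f : X -> \bar R) := exists x, f x != +oo%E.

Definition subdifferential (f : X -> \bar R) (x : X) : set (dual X) :=
  [set xs | forall y, (f x + (pairing (y - x) xs)%:E <= f y)%E].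

(* The operator [A_X]. *)
Definition partial_op (A : X * R^o -> set (dual X * R)) (x : X) :
    set (dual X) :=
  fst @` ((\bigcup_l A (x, l)) `&` (setT `*` [set -1])).

(* [prod_pairing] identifies [dual X * R] with the dual of [X * R^o]. *)
Lemma prod_pairing_continuous_linear (zs : dual X * R) :
  (prod_pairing ^~ zs : X * R^o -> R^o) \in continuous_linear.
Proof.
case: zs => -[f fP] m; have [lf cf] := asboolP _ fP; apply/asboolP; split=> [a u v|z].
  rewrite /prod_pairing /pairing /= lf /GRing.scale /= mulrDr mulrDl !mulrA.
  by rewrite addrACA.
have c1 : {for z, continuous (fun z : X * R^o => f z.1)}.
  by apply: continuous_comp; [exact: cvg_fst|exact: cf].
have c2 : {for z, continuous (fun z : X * R^o => z.2 * m : R^o)}.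
  apply: (@continuousM R (X * R^o)%type snd (cst m) z).
    exact: cvg_snd.
  exact: cst_continuous.
exact: continuousD c1 c2.
Qed.

Lemma prod_pairing_dual (phi : dual (X * R^o)%type) :
  exists! zs : dual X * R, forall z, phi z = prod_pairing z zs.
Proof.
case: phi => phi phiP; have [lphi cphi] := asboolP _ phiP.
have fP : (fun x => phi (x, 0) : R^o) \in @continuous_linear R X.
  apply/asboolP; split=> [a u v|x].
    by rewrite -lphi; congr phi; congr pair; rewrite /= scaler0 addr0.
  apply: (@continuous_comp _ _ _ (fun x : X => (x, 0 : R^o)) phi x);
    last exact: cphi.
  by apply: (@cvg_pair _ _ _ _ (nbhs x) (nbhs (0 : R^o)));
    [exact: cvg_id|exact: cvg_cst].
exists (Dual fP, phi (0, 1)); split=> [[x l]|[[g gP] m] /= Hg].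
  rewrite /prod_pairing /pairing /= addrC.
  rewrite -[l * _]/(l *: (phi (0, 1) : R^o)) -lphi.
  by congr phi; congr pair; rewrite /= ?scaler0 ?add0r // addr0 [l *: _]mulr1.
have [lg _] := asboolP _ gP.
have g0 : g 0 = 0.
  by have := lg (-1) 0 0; rewrite scaler0 addr0 scaleN1r addNr.
congr pair; last by rewrite Hg /prod_pairing /pairing /= g0 add0r mul1r.
apply: val_inj; apply/funext => x /=.
by rewrite Hg /prod_pairing /pairing /= mul0r addr0.
Qed.

End banach.

(* Main.v *)
Require Import Defs.
From HB Require Import structures.
From mathcomp Require Import all_boot all_order all_algebra.
From mathcomp Require Import all_classical all_reals all_analysis.
From mathcomp Require Import ring lra.

Set Implicit Arguments.
Unset Strict Implicit.
Unset Printing Implicit Defensive.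

Import Order.TTheory GRing.Theory Num.Theory.
Import numFieldNormedType.Exports.

Local Open Scope classical_set_scope.
Local Open Scope ring_scope.

(** Why the theorem holds.

If [T] is the subdifferential of [f], take for [A] the normal cone operator of
the epigraph of [f].  Its domain is the epigraph, which is already closed and
convex; a normal of the form [(xs, -1)] at [(x, l)] is the same thing as a
subgradient [xs] of [f] at [x]; the zero vector is normal everywhere; the
direction [(0, 1)] recedes because an epigraph is unbounded above; and every
subgradient supports the epigraph, so it lies in its barrier cone.

Conversely, given [A], put at [y]
  [f y = sup { l + <y - z, zs> : (zs, -1) \in A (z, l) }],
a supremum of continuous affine functions, hence convex and lower
semicontinuous.  Monotonicity between [(zs, -1) \in A (z, l)] and the pair
[(0, 0) \in A (x, m)] says exactly that the affine function attached to the
former is at most [m] at [x]; therefore [f x = m] whenever [A (x, m)] contains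
some [(xs, -1)], and the corresponding affine minorant is exact there.  So [A_X]
is contained in the subdifferential of [f], which is monotone, and maximality
of [T] forces equality.

The substantial ingredient is Rockafellar's theorem
([subdifferential_maximally_monotone]): the subdifferential of a proper lower
semicontinuous convex function on a Banach space is maximally monotone.  Let
[(x0, x0s)] be monotonically related to the subdifferential of [f] and perturb
[f] by [k y = e |y - x0|^2 + 2 e |y - x0| - <y, x0s>].  Then [f + k] is bounded
below, and Ekeland's principle gives a point [z] that minimizes
[f + k + e |. - z|].  The Hahn-Banach theorem splits this minimality into a
subgradient [zs] of [f] at [z] and a subgradient [- zs] of [k + e |. - z|].  The
second one, tested at [x0], yields
[<z - x0, zs - x0s> <= - e |z - x0|^2 - e |z - x0|], so that the monotone
relation forces [z = x0].  Hence [x0] itself minimizes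
[f - <., x0s> + e (|. - x0|^2 + 3 |. - x0|)] for every [e > 0], and letting [e]
tend to [0] shows that [x0s] is a subgradient of [f] at [x0]. *)

(** * The Hahn-Banach theorem *)

Section hahn_banach.
Context {R : realType} {X : lmodType R}.

Definition sublinear (p : X -> R) :=
  (forall x y, p (x + y) <= p x + p y) /\
  (forall t x, 0 < t -> p (t *: x) = t * p x).

Lemma sublinear0 p : sublinear p -> p 0 = 0.
Proof. by move=> [_ /(_ 2 0)]; rewrite scaler0 => /(_ ltac:(lra)); lra. Qed.

(** The lower boundary of a convex cone of [X * R] that projects onto [X] is a
sublinear function.  It is finite because [K (- x) s] and [K x r] force
[0 <= r + s].  This is the only way in which sublinear functions are produced
below: from a chain, from a perturbation along a direction, from a convex
set. *)
Lemma convex_cone_sublinear (K : X -> R -> Prop) :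
  (forall x y r s, K x r -> K y s -> K (x + y) (r + s)) ->
  (forall t x r, 0 < t -> K x r -> K (t *: x) (t * r)) ->
  (forall x, exists r, K x r) ->
  (forall r, K 0 r -> 0 <= r) ->
  exists2 p, sublinear p & forall x r, K x r -> p x <= r.
Proof.
move=> KD KZ Kx K0; pose p x := inf [set r | K x r].
have p_le x r : K x r -> p x <= r.
  move=> Kxr; apply: ge_inf => //; have [s Ks] := Kx (- x).
  exists (- s) => a /= Ka; have := K0 (a + s); rewrite -(subrr x).
  by move=> /(_ (KD _ _ _ _ Ka Ks)); lra.
have le_p x m : (forall r, K x r -> m <= r) -> m <= p x.
  by move=> mK; apply: lb_le_inf => //; have [r Kr] := Kx x; exists r.
have pZ t x : 0 < t -> p (t *: x) <= t * p x.
  move=> t0; rewrite mulrC -ler_pdivrMr//; apply/le_p => r Kr.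
  by rewrite ler_pdivrMr// mulrC; apply: p_le; exact: KZ.
exists p => //; split=> [x y|t x t0].
  rewrite -lerBlDr; apply/le_p => r Kr; rewrite lerBlDl -lerBlDr.
  by apply/le_p => s Ks; rewrite lerBlDl; apply: p_le; exact: KD.
apply/eqP; rewrite eq_le pZ//= mulrC -ler_pdivlMr// mulrC.
have := pZ t^-1 (t *: x); rewrite scalerA mulVf ?scale1r ?gt_eqF//.
by apply; rewrite invr_gt0.
Qed.

(** Zorn's lemma for the reverse pointwise order: the pointwise infimum of a
chain of sublinear functions is sublinear, by the lemma on cones applied to the
union of their epigraphs. *)
Lemma exists_minimal_sublinear (p : X -> R) : sublinear p ->
  exists q, [/\ sublinear q, forall x, q x <= p x &
    forall q', sublinear q' -> (forall x, q' x <= q x) -> q' = q].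
Proof.
move=> sp; pose Q := {q : X -> R | sublinear q /\ forall x, q x <= p x}.
pose ge_fun (q q' : Q) := `[< forall x, sval q' x <= sval q x >].
have [||||[q [sq qp]] qmin] := @Zorn Q ge_fun.
- by move=> q; apply/asboolP.
- move=> q1 q2 q3 /asboolP le21 /asboolP le32; apply/asboolP => x.
  exact: le_trans (le32 x) (le21 x).
- move=> [q1 P1] [q2 P2] /asboolP le21 /asboolP le12; apply: eq_exist => /=.
  by apply/funext => x; apply/eqP; rewrite eq_le le12 le21.
- move=> F Ftot; have [[q1 Fq1]|F0] := pselect (F !=set0); last first.
    by exists (exist _ p (conj sp (fun=> lexx _))) => q Fq; case: F0; exists q.
  have [||||q sq q_le] := @convex_cone_sublinear
      (fun x r => exists2 q : Q, F q & sval q x <= r).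
  + move=> x y r s [q2 Fq2 q2r] [q3 Fq3 q3s].
    have [/asboolP le|/asboolP le] := Ftot _ _ Fq2 Fq3;
      [exists q3|exists q2] => //.
      by have [[+ _] _] := svalP q3 => /(_ x y); have := le x; lra.
    by have [[+ _] _] := svalP q2 => /(_ x y); have := le y; lra.
  + move=> t x r t0 [q2 Fq2 q2r]; exists q2 => //.
    by have [[_ ->//] _] := svalP q2; rewrite ler_pM2l.
  + by move=> x; exists (sval q1 x); exists q1.
  + by move=> r [q2 Fq2]; have [/sublinear0-> _] := svalP q2.
  have q_p x : q x <= p x.
    apply: (@le_trans _ _ (sval q1 x)); last by have [_] := svalP q1.
    by apply: q_le; exists q1.
  exists (exist _ q (conj sq q_p)) => q2 Fq2; apply/asboolP => x /=.
  by apply: q_le; exists q2.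
exists q; split=> // q' sq' q'q.
have q'p x : q' x <= p x by exact: le_trans (q'q x) (qp x).
exact: (congr1 sval (qmin (exist _ q' (conj sq' q'p)) (asboolT q'q))).
Qed.

(** Replacing [q x] by the infimum over [t >= 0] of [q (x + t y) - t q y] gives
a sublinear function below [q], which must be [q] itself; the choice [t = 1]
then reads [q x <= q (x + y) - q y]. *)
Lemma minimal_sublinearD (q : X -> R) : sublinear q ->
  (forall q', sublinear q' -> (forall x, q' x <= q x) -> q' = q) ->
  forall x y, q (x + y) = q x + q y.
Proof.
move=> sq qmin x y; have [qD qZ] := sq; apply/eqP; rewrite eq_le qD /=.
have qZ0 t z : 0 <= t -> q (t *: z) = t * q z.
  rewrite le_eqVlt => /predU1P[<-|/qZ//].
  by rewrite scale0r mul0r; exact: sublinear0.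
have [||||q' sq' q'_le] := @convex_cone_sublinear
    (fun x r => exists2 t, 0 <= t & q (x + t *: y) - t * q y <= r).
- move=> x1 x2 r1 r2 [t t0 tr] [s s0 sr].
  exists (t + s); first exact: addr_ge0.
  have := qD (x1 + t *: y) (x2 + s *: y).
  by rewrite addrACA -scalerDl mulrDl; lra.
- move=> a z r a0 [t t0 tr]; exists (a * t); first by rewrite mulr_ge0 // ltW.
  by rewrite -scalerA -scalerDr qZ// -mulrA -mulrBr ler_pM2l.
- by move=> z; exists (q (z + 0 *: y) - 0 * q y); exists 0.
- by move=> r [t t0]; rewrite add0r qZ0// subrr.
have q'q : q' = q.
  apply: qmin => // z; apply: q'_le; exists 0 => //.
  by rewrite scale0r addr0 mul0r subr0.
rewrite -lerBrDr -{1}q'q; apply: q'_le; exists 1 => //.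
by rewrite scale1r mul1r.
Qed.

(** A minimal sublinear function is additive, hence odd, hence linear; this
replaces the usual extension of functionals from subspaces. *)
Theorem hahn_banach_cone (K : X -> R -> Prop) :
  (forall x y r s, K x r -> K y s -> K (x + y) (r + s)) ->
  (forall t x r, 0 < t -> K x r -> K (t *: x) (t * r)) ->
  (forall x, exists r, K x r) ->
  (forall r, K 0 r -> 0 <= r) ->
  exists2 u : X -> R^o, linear u & forall x r, K x r -> u x <= r.
Proof.
move=> KD KZ Kx K0; have [p sp pK] := convex_cone_sublinear KD KZ Kx K0.
have [u [su up umin]] := exists_minimal_sublinear sp.
exists u => [|x r Kxr]; last exact: le_trans (up x) (pK _ _ Kxr).
have uD := minimal_sublinearD su umin; have u0 := sublinear0 su.
have uN x : u (- x) = - u x.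
  by apply/eqP; rewrite -addr_eq0 -uD addNr u0.
move=> a x y; rewrite uD; congr (_ + _); rewrite -[RHS]/(a * u x).
have [a0|a0|->] := ltgtP a 0; last by rewrite scale0r mul0r.
- have [_ uZ] := su; rewrite -{1}[a]opprK scaleNr uN uZ ?oppr_gt0//.
  by rewrite mulNr opprK.
- by have [_ ->] := su.
Qed.

(** Hahn-Banach for a convex set: if a convex subset of [X * R] projects onto
[X] and lies in the upper half of the vertical axis, then so does the cone that
it generates. *)
Theorem hahn_banach_convex (C : X -> R -> Prop) :
  (forall x y r s t, 0 < t < 1 -> C x r -> C y s ->
     C (t *: x + (1 - t) *: y) (t * r + (1 - t) * s)) ->
  (forall x, exists r, C x r) ->
  (forall r, C 0 r -> 0 <= r) ->
  exists2 u : X -> R^o, linear u & forall x r, C x r -> u x <= r.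
Proof.
move=> Cconv Cx C0.
pose K x r := exists2 t, 0 < t & C (t *: x) (t * r).
have [||||u lu uK] := @hahn_banach_cone K.
- move=> x y r s [a a0 Ca] [b b0 Cb].
  have ab0 : 0 < a + b by rewrite addr_gt0.
  have abn0 : a + b != 0 by rewrite gt_eqF.
  exists (a * b / (a + b)); first by rewrite divr_gt0// mulr_gt0.
  have b01 : 0 < b / (a + b) < 1.
    by rewrite divr_gt0// ltr_pdivrMr// mul1r ltrDr.
  have := Cconv _ _ _ _ _ b01 Ca Cb; rewrite !scalerA scalerDr.
  have -> : (1 - b / (a + b)) * b = a * b / (a + b) by field.
  have -> : b / (a + b) * a = a * b / (a + b) by field.
  by congr C; field.
- move=> t x r t0 [a a0 Ca]; exists (a / t); first exact: divr_gt0.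
  by rewrite scalerA mulrA divfK// gt_eqF.
- by move=> x; have [r Cr] := Cx x; exists r, 1; rewrite ?scale1r ?mul1r.
- move=> r [t t0]; rewrite scaler0 => /C0.
  by rewrite pmulr_rge0.
by exists u => // x r Cr; apply: uK; exists 1; rewrite ?scale1r ?mul1r.
Qed.

End hahn_banach.

(** * Ekeland's variational principle *)

Section ekeland.
Context {R : realType} {X : completeNormedModType R}.

(** Say that [(y, b)] improves on [(x, a)] when [b + e |y - x| <= a].  The
sequence chooses, at each step, an improvement whose second component is within
[1 / (n + 1)] of the best one. *)
Lemma ekeland_sequence (E : set (X * R^o)) (m e : R) :
  E !=set0 -> (forall x (a : R), E (x, a) -> m <= a) ->
  exists (x : nat -> X) (a : nat -> R), [/\ forall n, E (x n, a n),
    forall n, a n.+1 + e * `|x n.+1 - x n| <= a n &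
    forall n y (b : R), E (y, b) -> b + e * `|y - x n| <= a n ->
      a n.+1 <= b + n.+1%:R^-1].
Proof.
move=> [[x0 a0] E0] Em; pose E' := {z : X * R^o | E z}.
have next (nz : nat * E') : exists z : E',
    (sval z).2 + e * `|(sval z).1 - (sval nz.2).1| <= (sval nz.2).2 /\
    forall y (b : R), E (y, b) ->
      b + e * `|y - (sval nz.2).1| <= (sval nz.2).2 ->
      (sval z).2 <= b + nz.1.+1%:R^-1.
  case: nz => n [[x a] Exa] /=.
  pose B := [set b : R | exists2 y, E (y, b) & b + e * `|y - x| <= a].
  have infB : has_inf B.
    split; last by exists m => b [y /Em].
    by exists a, x => //; rewrite subrr normr0 mulr0 addr0.
  have n0 : 0 < n.+1%:R^-1 :> R by rewrite invr_gt0 ltr0n.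
  have [b [y Eyb yx] binf] := inf_adherent n0 infB.
  exists (exist _ (y, b) Eyb); split=> //= y' b' Eyb' y'x.
  apply: (le_trans (ltW binf)); rewrite lerD2r.
  apply: ge_inf; last by exists y'.
  by case: infB.
have [nxt nxtP] := choice next.
pose w := fix w n : E' :=
  if n is n'.+1 then nxt (n', w n') else exist _ (x0, a0) E0.
exists (fun n => (sval (w n)).1), (fun n => (sval (w n)).2); split=> n /=.
- by rewrite -surjective_pairing; exact: svalP.
- by have [] := nxtP (n, w n).
- by have [_] := nxtP (n, w n).
Qed.

(** Ekeland's principle for a closed subset of [X * R], in place of a lower
semicontinuous function: with an epigraph for [E] it speaks of values of a
function without any infinite one.  The second components of an improving
sequence decrease and bound the steps of the first ones, so the sequence
converges in [E]; its limit improves on all its terms, so anything better than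
the limit would contradict the near-optimal choice of the terms. *)
Theorem ekeland_closed (E : set (X * R^o)) (m e : R) : 0 < e ->
  closed E -> E !=set0 -> (forall x (a : R), E (x, a) -> m <= a) ->
  exists x (a : R), E (x, a) /\
    forall y (b : R), E (y, b) -> a <= b + e * `|y - x|.
Proof.
move=> e0 clE E0 Em; have [x [a [Exa aS amin]]] := ekeland_sequence e E0 Em.
have a_le n k : a (n + k)%N + e * `|x (n + k)%N - x n| <= a n.
  elim: k => [|k IH]; first by rewrite addn0 subrr normr0 mulr0 addr0.
  rewrite addnS; apply: le_trans IH; have := aS (n + k)%N.
  have := ler_distD (x (n + k)%N) (x (n + k).+1) (x n).
  by rewrite -(ler_pM2l e0) mulrDr; lra.
have a_noninc : nonincreasing_seq a.
  apply/nonincreasing_seqP => n; have := aS n.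
  have := mulr_ge0 (ltW e0) (normr_ge0 (x n.+1 - x n)); lra.
have a_cvg : cvgn a.
  apply: nonincreasing_is_cvgn => //.
  by exists m => _ [n _ <-]; exact: Em (Exa n).
have [l a_l] : exists l : R, a @ \oo --> l by apply/cvg_ex.
have l_le n : l <= a n.
  by rewrite -(cvg_lim _ a_l)//; exact: nonincreasing_cvgn_ge.
have [p x_p] : exists p : X, x @ \oo --> p.
  apply/cvg_ex; apply/cauchy_cvgP/cauchy_exP => d d0.
  have /cvgrPdist_lt/(_ (e * d))[|N _ aN] := a_l; first exact: mulr_gt0.
  exists (x N); exists N => // n /= Nn; rewrite -ball_normE /= distrC.
  have := aN _ (leqnn N); rewrite ltr_norml => /andP[aN1 _].
  have := a_le N (n - N)%N; rewrite subnKC// => aNn.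
  by rewrite -(ltr_pM2l e0); have := l_le n; lra.
have Epl : E (p, l).
  have := closed_cvg (F := \oo) (u_ := fun n => (x n, a n : R^o)) E clE
    (nearW _ Exa) (p, l); apply.
  exact: (@cvg_pair _ _ _ _ (nbhs p) (nbhs (l : R^o))).
have pl_le n : l + e * `|p - x n| <= a n.
  have lim_n : (fun k => a k + e * `|x k - x n|) @ \oo --> l + e * `|p - x n|.
    apply: cvgD => //; apply: cvgMr; apply: cvg_norm.
    by apply: cvgB => //; exact: cvg_cst.
  rewrite -(cvg_lim _ lim_n)//; apply: limr_le.
    by apply/cvg_ex; eexists; exact: lim_n.
  by exists n => // k /= nk; have := a_le n (k - n)%N; rewrite subnKC.
exists p, l; split=> // y b Eyb; rewrite leNgt; apply/negP => yp.
have b_le n : b + e * `|y - x n| <= a n.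
  apply: le_trans (pl_le n); have := ler_distD p y (x n).
  by rewrite -(ler_pM2l e0) mulrDr; lra.
suff : l <= b by have := mulr_ge0 (ltW e0) (normr_ge0 (y - p)); lra.
apply/ler_addgt0Pr => d d0.
have [n _ /(_ _ (leqnn n)) nd] := near_infty_natSinv_lt (PosNum d0).
apply: le_trans (l_le n.+1) (le_trans (amin n y b Eyb (b_le n)) _).
by rewrite lerD2l; exact: ltW.
Qed.

End ekeland.

(** * Continuous functionals and epigraphs *)

Section dual_pairing.
Context {R : realType} {X : normedModType R}.
Implicit Types (x y : X) (xs ys : dual X).

Lemma pairingDl xs x y : pairing (x + y) xs = pairing x xs + pairing y xs.
Proof.
have [lx _] := asboolP _ (dual_funP xs).
by have := lx 1 x y; rewrite !scale1r.
Qed.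

Lemma pairingZl xs (a : R) x : pairing (a *: x) xs = a * pairing x xs.
Proof.
have [lx _] := asboolP _ (dual_funP xs); have := lx a x 0.
have x0 : xs 0 = 0 :> R.
  by have := lx (-1) 0 0; rewrite scaler0 addr0 scaleN1r addNr.
by rewrite addr0 x0 addr0.
Qed.

Lemma pairingNl xs x : pairing (- x) xs = - pairing x xs.
Proof. by rewrite -scaleN1r pairingZl mulN1r. Qed.

Lemma pairingBl xs x y : pairing (x - y) xs = pairing x xs - pairing y xs.
Proof. by rewrite pairingDl pairingNl. Qed.

Lemma pairingBr x xs ys : pairing x (xs - ys) = pairing x xs - pairing x ys.
Proof. by []. Qed.

Lemma prod_pairingBr (z : X * R^o) (us vs : dual X * R) :
  prod_pairing z (us - vs) = prod_pairing z us - prod_pairing z vs.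
Proof.
rewrite /prod_pairing -[(us - vs).1]/(us.1 - vs.1) -[(us - vs).2]/(us.2 - vs.2).
by rewrite pairingBr mulrBr opprD addrACA.
Qed.

Lemma pairing0r x : pairing x 0 = 0.
Proof. by []. Qed.

Lemma continuous_pairing xs : continuous (pairing ^~ xs).
Proof. by have [_] := asboolP _ (dual_funP xs). Qed.

Lemma pairing_le xs : exists2 M, 0 < M & forall x, `|pairing x xs| <= M * `|x|.
Proof.
have [lx cx] := asboolP _ (dual_funP xs).
pose L : {linear X -> R^o} :=
  HB.pack (dual_fun xs) (GRing.isLinear.Build R X R^o *:%R (dual_fun xs) lx).
have /linear_boundedP[M [_ LM]] : bounded_near L (nbhs 0).
  exact/linear_bounded_continuous.
exists (`|M| + 1); first by rewrite ltr_wpDl.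
by move=> x; apply: LM; rewrite (le_lt_trans (ler_norm M))// ltrDl.
Qed.

(** A linear function below a function that is continuous at [0] and vanishes
there is bounded near [0], from both sides by linearity. *)
Lemma dual_of_dominated (u : X -> R^o) (h : X -> R) : linear u ->
  {for 0, continuous h} -> h 0 = 0 -> (forall x, u x <= h (- x)) ->
  exists us : dual X, forall x, pairing x us = u x.
Proof.
move=> lu ch h0 uh; suff uP : u \in continuous_linear by exists (Dual uP).
apply/asboolP; split=> //.
pose L : {linear X -> R^o} :=
  HB.pack u (GRing.isLinear.Build R X R^o *:%R u lu).
apply/(linear_bounded_continuous L)/ex_bound; exists 1.
have h1 : \forall x \near (0 : X), `|h x| < 1.
  have /cvgrPdist_lt/(_ 1 ltr01) := ch; rewrite h0.
  by apply: filterS => x; rewrite sub0r normrN.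
have h1N : \forall x \near (0 : X), `|h (- x)| < 1.
  have : (- x : X) @[x --> (0 : X)] --> (0 : X).
    by rewrite -[X in _ --> X]oppr0; apply: cvgN; exact: cvg_id.
  by move=> /(_ _ h1).
near=> x; have uN : u (- x) = - u x by exact: (raddfN L).
suff : `|u x : R| <= 1 by [].
rewrite ler_norml lerNl -uN (le_trans (uh _))/= ?opprK.
  rewrite (le_trans (uh _))// (le_trans (ler_norm _))// ltW//.
  by near: x.
by rewrite (le_trans (ler_norm _))// ltW//; near: x.
Unshelve. all: by end_near. Qed.

End dual_pairing.

Section epigraph.
Context {R : realType} {X : normedModType R}.
Implicit Types f : X -> \bar R.

Definition epigraph f : set (X * R^o) := [set z | (f z.1 <= z.2%:E)%E].

(** Below a point under the graph there is room for a real [b] strictly between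
[a] and [f x], and lower semicontinuity at level [b] gives a neighbourhood that
misses the epigraph. *)
Lemma closed_epigraph f : lower_semicontinuous f -> closed (epigraph f).
Proof.
move=> lscf [x a] clxa; rewrite /epigraph /= leNgt; apply/negP => afx.
have [b ab bfx] : exists2 b : R, a < b & (b%:E < f x)%E.
  case: (f x) afx => [c|_|//]; last by exists (a + 1); rewrite ?ltrDl ?ltry.
  rewrite lte_fin => ac; exists ((a + c) / 2); rewrite ?lte_fin; lra.
have [V Vx Vf] := lscf _ _ bfx.
have [|[y c] /= [fyc [Vy cb]]] := clxa (V `*` [set c | c < b]).
  by exists (V, [set c : R^o | c < b]) => //; split => //=; exact: lt_nbhsl.
have := lt_le_trans (Vf _ Vy) fyc; rewrite lte_fin => bc.
by have := lt_trans bc cb; rewrite ltxx.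
Qed.

Lemma convex_epigraph f x y (a b t : R) : convex_efun f -> 0 < t < 1 ->
  (f x <= a%:E -> f y <= b%:E ->
   f (t *: x + (1 - t) *: y)%R <= (t * a + (1 - t) * b)%:E)%E.
Proof.
move=> cf t01 fxa fyb; apply: le_trans (cf x y t t01) _.
have /andP[t0 t1] := t01; rewrite [leRHS]EFinD !EFinM leeD//.
  by rewrite lee_pmul2l// lte_fin.
by rewrite lee_pmul2l// lte_fin subr_gt0.
Qed.

End epigraph.

(** * Maximal monotonicity of subdifferentials *)

Section rockafellar.
Context {R : realType}.

(** Minimality of [f + h (. - z)] at [z] splits into a subgradient [zs] of [f]
and a subgradient [- zs] of [h].  The set [C] is the epigraph, up to its
boundary, of the infimal convolution
[d |-> inf { f (z + w + d) - c + h w : w }].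
The linear function that the Hahn-Banach theorem puts below [C] is bounded above
by [f (z + .) - c] (take [w = 0]) and by [h] composed with the opposite (take
[d = - w]); the latter makes it continuous. *)
Lemma subgradient_sandwich (X : normedModType R) (f : X -> \bar R) (h : X -> R)
    (z : X) (c : R) :
  convex_efun f -> f z = c%:E ->
  convex_efun (EFin \o h) -> {for 0, continuous h} -> h 0 = 0 ->
  (forall y b, (f y <= b%:E)%E -> c <= b + h (y - z)) ->
  exists2 zs, subdifferential f z zs & forall w, - pairing w zs <= h w.
Proof.
move=> cf fz cvxh conth h0 fh.
pose C (d : X) (r : R) := exists w (b : R),
  (f (z + w + d)%R <= b%:E)%E /\ b - c + h w <= r.
have [|||u lu uC] := @hahn_banach_convex R X C.
- move=> x y r s t t01 [w [b [fb br]]] [w' [b' [fb' bs]]].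
  exists (t *: w + (1 - t) *: w'), (t * b + (1 - t) * b'); split.
    suff -> : z + (t *: w + (1 - t) *: w') + (t *: x + (1 - t) *: y) =
        t *: (z + w + x) + (1 - t) *: (z + w' + y).
      exact: convex_epigraph.
    rewrite !scalerDr [RHS]addrACA; congr (_ + _).
    by rewrite [RHS]addrACA -scalerDl [t + _]addrC subrK scale1r.
  have := cvxh w w' t t01; rewrite /= -!EFinM -EFinD lee_fin => hw.
  have /andP[t0 t1] := t01; have {t1} t1 : 0 < 1 - t by rewrite subr_gt0.
  have := ler_wpM2l (ltW t0) br; have := ler_wpM2l (ltW t1) bs; lra.
- by move=> d; exists (c - c + h (- d)), (- d), c; rewrite subrK fz.
- by move=> r [w [b [/fh + hr]]]; rewrite addr0 [z + w]addrC addrK; lra.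
have u_le y b : (f y <= b%:E)%E -> u (y - z) <= b - c.
  move=> fyb; apply: uC; exists 0, b; rewrite h0 !addr0; split=> //.
  by rewrite addrC subrK.
have u_leN w : u (- w) <= h w.
  by apply: uC; exists w, c; rewrite addrK fz subrr add0r.
have [zs zsE] : exists us : dual X, forall x, pairing x us = u x.
  by apply: (dual_of_dominated lu conth h0) => x; rewrite -{1}[x]opprK.
exists zs => [y|w]; last by rewrite -pairingNl zsE.
rewrite fz zsE -EFinD; case fyE : (f y) => [b| |]; last 2 first.
- by rewrite leey.
  (* If [f y] were [-oo], every real would bound it from above; take one below
     the value of the affine minorant. *)
- exfalso; have := u_le y (c + u (y - z) - 1).
  rewrite fyE leNye => /(_ isT); lra.
by rewrite lee_fin; have := u_le y b; rewrite fyE lexx => /(_ isT); lra.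
Qed.

(** Ekeland's principle for [f + k], whose epigraph is the image of that of [f]
under the shear [(x, a) |-> (x, a + k x)], followed by the sandwich lemma with
the convex function [h w = k (z + w) - k z + e |w|]. *)
Lemma approximate_minimizer_subgradient (X : completeNormedModType R)
    (f : X -> \bar R) (k : X -> R) (m e : R) :
  0 < e -> (forall x, f x != -oo%E) -> lower_semicontinuous f ->
  proper_efun f -> convex_efun f ->
  continuous k -> convex_efun (EFin \o k) ->
  (forall y b, (f y <= b%:E)%E -> m <= b + k y) ->
  exists z (c : R) zs, [/\ f z = c%:E,
    forall y b, (f y <= b%:E)%E -> c + k z <= b + k y + e * `|y - z|,
    subdifferential f z zs &
    forall w, - pairing w zs <= k (z + w) - k z + e * `|w|].
Proof.
move=> e0 fNoo lscf [x0 fx0] cf ck cvxk fkm.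
pose E : set (X * R^o) := (fun z => (z.1, z.2 - k z.1 : R^o)) @^-1` epigraph f.
have [|||z [a [/= Eza zmin]]] := @ekeland_closed R X E m e e0.
- apply: closed_comp; last exact: closed_epigraph.
  move=> z _; apply: (@cvg_pair _ _ _ _ (nbhs z.1) (nbhs (z.2 - k z.1 : R^o))).
    exact: cvg_fst.
  apply: (@continuousB R R^o (X * R^o)%type snd (k \o fst)).
    exact: cvg_snd.
  by apply: continuous_comp; [exact: cvg_fst|exact: ck].
- case fx0E : (f x0) fx0 (fNoo x0) => [b| |]// _ _.
  by exists (x0, b + k x0 : R^o); rewrite /E /epigraph /= addrK fx0E.
- by move=> x b /= /fkm; rewrite subrK.
have zmin' y b : (f y <= b%:E)%E -> a <= b + k y + e * `|y - z|.
  by move=> fyb; apply: zmin; rewrite /E /epigraph /= addrK.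
have {}Eza : (f z <= (a - k z)%:E)%E := Eza.
have [c fz] : exists c, f z = c%:E.
  exists (fine (f z)); rewrite fineK// fin_numE fNoo lt_eqF//.
  exact: le_lt_trans Eza (ltry _).
have ac : a = c + k z.
  apply/eqP; rewrite eq_le; apply/andP; split; last first.
    by move: Eza; rewrite fz lee_fin lerBrDr.
  by have := zmin' z c; rewrite fz lexx subrr normr0 mulr0 addr0; exact.
pose h w := k (z + w) - k z + e * `|w|.
have [||||zs fzs zsh] := @subgradient_sandwich X f h z c cf fz.
- move=> x y t t01; rewrite /= -!EFinM -EFinD lee_fin /h.
  have := cvxk (z + x) (z + y) t t01; rewrite /= -!EFinM -EFinD lee_fin.
  rewrite !scalerDr addrACA -scalerDl [t + _]addrC subrK scale1r => kxy.
  have /andP[t0 t1] := t01; have {t1} t1 : 0 < 1 - t by rewrite subr_gt0.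
  have := ler_normD (t *: x) ((1 - t) *: y).
  by rewrite !normrZ !gtr0_norm// => /(ler_wpM2l (ltW e0)); lra.
- apply: continuousD.
    apply: continuousB; last exact: cst_continuous.
    apply: continuous_comp; last exact: ck.
    by apply: continuousD; [exact: cst_continuous|exact: cvg_id].
  apply: continuousM; first exact: cst_continuous.
  exact: norm_continuous.
- by rewrite /h addr0 subrr normr0 mulr0 addr0.
- by move=> y b /zmin'; rewrite /h [z + _]addrC subrK ac; lra.
by exists z, c, zs; split=> // y b /zmin'; rewrite ac.
Qed.


(** Lower semicontinuity at a point [x0] of finiteness keeps [f] above
[f x0 - 1] on a ball of radius [d]; for a [y] farther away, convexity on the
segment from [x0] to [y], used at the point at distance [d / 2] from [x0],
turns this into a bound with slope [2 / d].  This makes quadratic perturbations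
of [f] bounded below without any separation theorem. *)
Lemma convex_lsc_lower_bound (X : normedModType R) (f : X -> \bar R) (x1 : X) :
  (forall x, f x != -oo%E) -> lower_semicontinuous f -> proper_efun f ->
  convex_efun f ->
  exists c K, forall y b, (f y <= b%:E)%E -> c - K * `|y - x1| <= b.
Proof.
move=> fNoo lscf [x0 fx0] cf.
have [c fx0E] : exists c, f x0 = c%:E.
  by exists (fine (f x0)); rewrite fineK// fin_numE fNoo.
have [|V /nbhs_ballP[d /= d0 dV] Vf] := lscf x0 (c - 1).
  by rewrite fx0E lte_fin ltrBlDr ltrDl.
pose K := 2 / d; have K0 : 0 < K by rewrite divr_gt0.
exists (c - 1 - K * `|x1 - x0|), K => y b fyb.
suff bound : c - 1 - K * `|y - x0| <= b.
  have := ler_wpM2l (ltW K0) (ler_distD x1 y x0).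
  by rewrite mulrDr; lra.
have ball_gt p (a : R) : `|p - x0| < d -> (f p <= a%:E)%E -> c - 1 < a.
  move=> px0 fpa; rewrite -lte_fin; apply: lt_le_trans fpa; apply: Vf.
  by apply: dV; rewrite -ball_normE /= distrC.
have [yd|yd] := ltP `|y - x0| d.
  have := ball_gt _ _ yd fyb.
  have := mulr_ge0 (ltW K0) (normr_ge0 (y - x0)); lra.
set r := `|y - x0| in yd *; have r0 : 0 < r by exact: lt_le_trans yd.
pose t := d / (2 * r); have t0 : 0 < t by rewrite divr_gt0// mulr_gt0.
have t1 : t < 1 by rewrite ltr_pdivrMr ?mulr_gt0//; lra.
have t01 : 0 < t < 1 by rewrite t0.
have tKr : t * (K * r) = 1.
  by rewrite /t /K; field; rewrite !gt_eqF.
have fx0c : (f x0 <= c%:E)%E by rewrite fx0E.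
have /ball_gt : `|t *: y + (1 - t) *: x0 - x0| < d.
  rewrite scalerBl scale1r [x0 - _]addrC addrA addrK -scalerBr.
  rewrite normrZ gtr0_norm//.
  rewrite -/r /t (_ : _ * r = d / 2); last by field; rewrite gt_eqF.
  lra.
move=> /(_ _ (convex_epigraph cf t01 fyb fx0c)) tb.
have tb1 : 0 < t * (b - c) + 1 by lra.
have Kr0 : 0 < K * r by exact: mulr_gt0.
have := mulr_gt0 Kr0 tb1; rewrite mulrDr mulrA [_ * t]mulrC tKr; lra.
Qed.

Lemma subdifferential_fin (X : normedModType R) (f : X -> \bar R) x xs :
  (forall x, f x != -oo%E) -> proper_efun f -> subdifferential f x xs ->
  exists c : R, f x = c%:E.
Proof.
move=> fNoo [y fy] /(_ y); move: (fNoo x) fy.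
by case: (f x) => [c| |]// _ fy; [exists c|rewrite addye// leye_eq (negbTE fy)].
Qed.

Lemma subdifferential_monotone (X : normedModType R) (f : X -> \bar R) :
  (forall x, f x != -oo%E) -> proper_efun f ->
  monotone_op pairing (subdifferential f).
Proof.
move=> fNoo fprop x y xs ys fxs fys.
have [a fx] := subdifferential_fin fNoo fprop fxs.
have [b fy] := subdifferential_fin fNoo fprop fys.
have := fxs y; have := fys x.
rewrite fx fy -!EFinD !lee_fin !pairingBr !pairingBl.
lra.
Qed.

(** Every point that is monotonically related to the subdifferential of [f]
belongs to it.  In the perturbation [k], the coefficient [2 e] of the norm beats
the slack [e] of Ekeland's principle, which is what forces its point to be [x0]
exactly, and not merely close to [x0]; the quadratic term serves only to bound
[f + k] from below. *)
Lemma subdifferential_of_monotone_related (X : completeNormedModType R)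
    (f : X -> \bar R) (x0 : X) (x0s : dual X) :
  (forall x, f x != -oo%E) -> lower_semicontinuous f -> proper_efun f ->
  convex_efun f ->
  (forall z zs, subdifferential f z zs -> 0 <= pairing (z - x0) (zs - x0s)) ->
  subdifferential f x0 x0s.
Proof.
move=> fNoo lscf fprop cf rel.
have almost e : 0 < e -> exists2 c : R, f x0 = c%:E &
    forall y b, (f y <= b%:E)%E ->
    c + pairing (y - x0) x0s <= b + e * (`|y - x0| ^+ 2 + 3 * `|y - x0|).
  move=> e0.
  pose k y := e * `|y - x0| ^+ 2 + 2 * e * `|y - x0| - pairing y x0s.
  have [c0 [K cK]] := convex_lsc_lower_bound x0 fNoo lscf fprop cf.
  have [M M0 x0sM] := pairing_le x0s.
  (* [(K + M)^2 / (4 e)] is the maximum of [(K + M) r - e r^2] over [r]. *)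
  pose m := c0 - pairing x0 x0s - (K + M) ^+ 2 / (4 * e).
  have [|||z [c [zs [fz zmin fzs zsk]]]] :=
      @approximate_minimizer_subgradient X f k m e e0 fNoo lscf fprop cf.
  - move=> y; rewrite /k; apply: cvgB; last exact: continuous_pairing.
    have cn : `|x - x0| @[x --> y] --> `|y - x0|.
      by apply: cvg_norm; apply: cvgB; [exact: cvg_id|exact: cvg_cst].
    by apply: cvgD; apply: cvgMr => //; rewrite !expr2; exact: cvgM.
  - move=> x y t t01; rewrite /= -!EFinM -EFinD lee_fin /k.
    have /andP[t0 t1] := t01; have {t1} t1 : 0 < 1 - t by rewrite subr_gt0.
    rewrite pairingDl !pairingZl.
    have : `|t *: x + (1 - t) *: y - x0| <= t * `|x - x0| + (1 - t) * `|y - x0|.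
      have -> : t *: x + (1 - t) *: y - x0 =
          t *: (x - x0) + (1 - t) *: (y - x0).
        rewrite !scalerBr addrACA -opprD -scalerDl.
        by rewrite [t + _]addrC subrK scale1r.
      by rewrite (le_trans (ler_normD _ _))// !normrZ !gtr0_norm.
    move: (normr_ge0 (t *: x + (1 - t) *: y - x0)).
    set n := `|_ - x0|; set p := `|x - x0|; set q := `|y - x0| => n0 nle.
    have n2 : n ^+ 2 <= t * p ^+ 2 + (1 - t) * q ^+ 2.
      have : n ^+ 2 <= (t * p + (1 - t) * q) ^+ 2.
        by rewrite ler_sqr ?nnegrE// (le_trans n0).
      have := mulr_ge0 (ltW (mulr_gt0 t0 t1)) (sqr_ge0 (p - q)); lra.
    have := ler_wpM2l (ltW e0) n2; have := ler_wpM2l (ltW e0) nle; lra.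
  - move=> y b /cK; rewrite /k /m.
    have := x0sM (y - x0); rewrite ler_norml => /andP[_].
    rewrite pairingBl; set r := `|_|.
    have -> : (K + M) ^+ 2 / (4 * e) =
        (2 * e * r - (K + M)) ^+ 2 / (4 * e) - e * r ^+ 2 + (K + M) * r.
      by field; rewrite gt_eqF.
    have : 0 <= (2 * e * r - (K + M)) ^+ 2 / (4 * e).
      by rewrite divr_ge0 ?sqr_ge0// mulr_ge0// ltW.
    have := mulr_ge0 (ltW e0) (normr_ge0 (y - x0)); rewrite -/r; lra.
  (* The subgradient inequality for [- zs], tested at [x0], against the
     monotone relation. *)
  have zx0 : z = x0.
    apply/eqP; rewrite -subr_eq0 -normr_le0 -(pmulr_rle0 _ e0).
    have := rel _ _ fzs; have := zsk (x0 - z).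
    rewrite /k [z + _]addrC subrK subrr normr0 (distrC x0 z).
    rewrite pairingBr !pairingBl.
    have := mulr_ge0 (ltW e0) (sqr_ge0 `|z - x0|); lra.
  subst z; exists c => // y b /zmin.
  rewrite /k subrr normr0 pairingBl; lra.
have [c fx0 _] := almost 1 ltr01.
move=> y; rewrite fx0 -EFinD.
case fy : (f y) (fNoo y) => [b| |]// _; last first.
  by rewrite leey.
rewrite lee_fin; apply/ler_addgt0Pr => d d0.
set N := `|y - x0| ^+ 2 + 3 * `|y - x0| + 1.
have N0 : 0 < N by rewrite ltr_wpDl// addr_ge0 ?sqr_ge0// mulr_ge0.
have [c'] := almost _ (divr_gt0 d0 N0); rewrite fx0 => -[<-] /(_ y b).
rewrite fy lexx => /(_ isT) /le_trans; apply; rewrite lerD2l.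
rewrite mulrAC ler_pdivrMr// ler_wpM2l ?(ltW d0)//.
by rewrite lerDl.
Qed.

Theorem subdifferential_maximally_monotone (X : completeNormedModType R)
    (f : X -> \bar R) :
  (forall x, f x != -oo%E) -> lower_semicontinuous f -> proper_efun f ->
  convex_efun f -> maximally_monotone_op pairing (subdifferential f).
Proof.
move=> fNoo lscf fprop cf; split; first exact: subdifferential_monotone.
move=> S Smono fS; apply/funext => x0; apply/seteqP; split; last exact: fS.
move=> x0s Sx0; apply: subdifferential_of_monotone_related => // z zs fzs.
by apply: Smono => //; exact: fS.
Qed.

End rockafellar.

(** * The normal cone operator of an epigraph *)

Section epigraph_normal_cone.
Context {R : realType} {X : normedModType R}.
Implicit Types (f : X -> \bar R) (C : set (X * R^o)).

Definition normal_cone C (z : X * R^o) : set (dual X * R) :=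
  [set zs | C z /\ forall w, C w -> prod_pairing (w - z) zs <= 0].

Lemma op_dom_normal_cone C : op_dom (normal_cone C) = C.
Proof.
apply/seteqP; split=> [z [zs [//]]|z Cz]; exists (0, 0); split=> // w _.
by rewrite /prod_pairing pairing0r mulr0 addr0.
Qed.

Lemma monotone_normal_cone C : monotone_op prod_pairing (normal_cone C).
Proof.
move=> z0 z1 z0s z1s [Cz0 nz0] [Cz1 nz1].
have := nz0 _ Cz1; have := nz1 _ Cz0.
rewrite prod_pairingBr /prod_pairing /= !pairingBl.
lra.
Qed.

(** The normals [(xs, -1)] at [(x, a)] are the [xs] with
[f y >= a + <y - x, xs>] for all [y]; since [a >= f x], they are subgradients,
and every subgradient arises with [a = f x]. *)
Lemma partial_op_normal_cone_epigraph f :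
  (forall x, f x != -oo%E) -> proper_efun f ->
  partial_op (normal_cone (epigraph f)) = subdifferential f.
Proof.
move=> fNoo fprop; apply/funext => x; apply/seteqP; split=> xs.
  move=> [[{}xs mu] /= [[a _ [/= fxa nxa]] [_ /= m1]] <-] y; rewrite m1 in nxa.
  have [c fx] : exists c, f x = c%:E.
    exists (fine (f x)); rewrite fineK// fin_numE fNoo lt_eqF//.
    exact: le_lt_trans fxa (ltry _).
  case fyE : (f y) (fNoo y) => [b| |]// _; last by rewrite leey.
  have := nxa (y, b); rewrite /epigraph /prod_pairing /= fyE lexx => /(_ isT).
  move: fxa; rewrite /epigraph /= fx -EFinD !lee_fin; lra.
move=> fxs; have [c fx] := subdifferential_fin fNoo fprop fxs.
exists (xs, -1) => //; split=> //; exists c => //; split.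
  by rewrite /epigraph /= fx.
move=> [y b] /= /(le_trans (fxs y)).
by rewrite fx -EFinD lee_fin /prod_pairing /=; lra.
Qed.

Lemma closure_conv_hull_epigraph f : lower_semicontinuous f -> convex_efun f ->
  closure (conv_hull (epigraph f)) = epigraph f.
Proof.
move=> lscf cf; rewrite /conv_hull smallest_id.
  by rewrite -(proj1 (closure_id _))//; exact: closed_epigraph.
apply/convex_setW => -[x a] [y b] /set_mem fxa /set_mem fyb t t0 t1.
have t01 : 0 < t%:num < 1 by rewrite t0.
by apply/mem_set; exact: (convex_epigraph cf t01 fxa fyb).
Qed.

Lemma barr_epigraph f x xs (c : R) : f x = c%:E -> subdifferential f x xs ->
  barr prod_pairing (epigraph f) (xs, -1).
Proof.
move=> fx fxs.
apply: (@le_lt_trans _ _ (pairing x xs - c)%:E); last exact: ltry.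
apply: ge_ereal_sup => _ [[y b] /= /(le_trans (fxs y)) fyb <-].
by move: fyb; rewrite fx -EFinD !lee_fin /prod_pairing /= pairingBl; lra.
Qed.

Lemma recession_cone_epigraph f : recession_cone (epigraph f) (0, 1).
Proof.
apply/seteqP; split=> [z [[x a] fxa [t /=]]|[x a] fxa].
  rewrite in_itv /= andbT => t0 <-; rewrite /epigraph /= scaler0 addr0.
  by apply: le_trans fxa _; rewrite lee_fin lerDl [t *: _]mulr1.
exists (x, a) => //; exists 0; first by rewrite /= in_itv /= lexx.
by rewrite scale0r addr0.
Qed.

End epigraph_normal_cone.

(** * The function recovered from a monotone operator *)

Section affine_envelope.
Context {R : realType} {X : normedModType R}.
Context (A : X * R^o -> set (dual X * R)).

(** A pair [(zs, -1) \in A (z, l)] is thought of as a normal at [(z, l)] to an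
epigraph, that is, as a non-vertical supporting hyperplane; the envelope is the
supremum of the affine functions whose graphs are these hyperplanes. *)
Definition affine_envelope (y : X) : \bar R :=
  ereal_sup [set v | exists z (l : R) zs,
    A (z, l) (zs, -1) /\ v = (l + pairing (y - z) zs)%:E].

Lemma affine_envelope_ge z (l : R) zs y : A (z, l) (zs, -1) ->
  ((l + pairing (y - z) zs)%:E <= affine_envelope y)%E.
Proof. by move=> Az; apply: ereal_sup_ubound; exists z, l, zs. Qed.

Lemma affine_envelope_lsc : lower_semicontinuous affine_envelope.
Proof.
move=> y a /ereal_sup_gt[_ [z [l [zs [Az ->]]]]]; rewrite lte_fin => ay.
exists [set x | a < l + pairing (x - z) zs].
  have cl : l + pairing (x - z) zs @[x --> y] --> l + pairing (y - z) zs.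
    apply: cvgD; first exact: cvg_cst.
    under eq_fun do rewrite pairingBl.
    rewrite pairingBl; apply: cvgB; last exact: cvg_cst.
    exact: continuous_pairing.
  by move/cvgr_gt: cl => /(_ _ ay).
move=> x /= ax; apply: lt_le_trans (affine_envelope_ge x Az).
by rewrite lte_fin.
Qed.

Lemma affine_envelope_convex : convex_efun affine_envelope.
Proof.
move=> x y t /andP[t0 t1]; apply: ge_ereal_sup => _ [z [l [zs [Az ->]]]].
have -> : l + pairing (t *: x + (1 - t) *: y - z) zs =
    t * (l + pairing (x - z) zs) + (1 - t) * (l + pairing (y - z) zs).
  by rewrite !pairingBl pairingDl !pairingZl; ring.
rewrite EFinD !EFinM leeD// lee_wpmul2l ?lee_fin ?subr_ge0 ?(ltW t0) ?(ltW t1)//.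
  exact: affine_envelope_ge.
exact: affine_envelope_ge.
Qed.

Context (A_monotone : monotone_op prod_pairing A).
Context (A_zero : (\bigcap_(z in op_dom A) A z) (0, 0)).

(** The affine function attached to [(xs, -1)] takes the value [l] at [x]; the
others do not exceed [l] there, by monotonicity of [A] between [(0, 0)], which
belongs to [A (x, l)], and the pairs that define them. *)
Lemma affine_envelope_eq x (l : R) xs : A (x, l) (xs, -1) ->
  affine_envelope x = l%:E.
Proof.
move=> Axl; apply/eqP; rewrite eq_le; apply/andP; split; last first.
  have := affine_envelope_ge x Axl.
  by rewrite pairingBl subrr addr0.
apply: ge_ereal_sup => _ [z [m [zs [Azm ->]]]]; rewrite lee_fin.
have dom_xl : op_dom A (x, l) by exists (xs, -1).
have := A_monotone (A_zero dom_xl) Azm.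
rewrite prod_pairingBr /prod_pairing pairing0r /= !pairingBl; lra.
Qed.

Lemma partial_op_sub_subdifferential x :
  partial_op A x `<=` subdifferential affine_envelope x.
Proof.
move=> _ [[xs mu] [[l _ Axl] [_ /= m1]] <-] y; rewrite m1 in Axl.
by rewrite (affine_envelope_eq Axl) -EFinD; exact: affine_envelope_ge.
Qed.

End affine_envelope.

(** The empty operator is properly contained in the monotone operator with the
single pair [(0, 0)]. *)
Lemma maximally_monotone_nonempty (R : realType) (X : normedModType R)
    (T : X -> set (dual X)) :
  maximally_monotone_op pairing T -> exists x xs, T x xs.
Proof.
move=> [_ Tmax]; apply: contrapT => T0.
have T0' x xs : ~ T x xs by move=> Txs; apply: T0; exists x, xs.
have /(congr1 (fun S : X -> set (dual X) => S 0 0)) :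
    (fun x : X => [set xs : dual X | x = 0 /\ xs = 0]) = T.
  apply: Tmax => [x y xs ys [_ ->] [_ ->]|x xs /T0'//].
  by rewrite subrr pairing0r.
move=> T00; apply: (T0' 0 0); rewrite -T00.
by split.
Qed.


(** * The characterization *)

Theorem theorem3p1 (R : realType) (X : completeNormedModType R)
    (T : X -> set (dual X)) :
  (exists f : X -> \bar R,
    [/\ forall x, f x != -oo%E,
        lower_semicontinuous f,
        proper_efun f,
        convex_efun f &
        T = subdifferential f])
  <->
  (maximally_monotone_op pairing T /\
   exists A : X * R^o -> set (dual X * R),
    [/\ monotone_op prod_pairing A,
        T = partial_op A,
        barr prod_pairing (closure (conv_hull (op_dom A))) `&` (setT `*` [set -1]) !=set0,
        recession_cone (closure (conv_hull (op_dom A))) (0, 1) &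
        (\bigcap_(z in op_dom A) A z) (0, 0)]).
Proof.
split=> [[f [fNoo lscf fprop cf ->]]|[maxT [A [Amono TA _ _ A0]]]].
  have maxf := subdifferential_maximally_monotone fNoo lscf fprop cf.
  have [x [xs fxs]] := maximally_monotone_nonempty maxf.
  have [c fx] := subdifferential_fin fNoo fprop fxs.
  split=> //; exists (normal_cone (epigraph f)).
  rewrite op_dom_normal_cone closure_conv_hull_epigraph//; split.
  - exact: monotone_normal_cone.
  - by rewrite partial_op_normal_cone_epigraph.
  - by exists (xs, -1); split=> //; exact: barr_epigraph fx fxs.
  - exact: recession_cone_epigraph.
  - move=> z Cz; split=> // w _.
    by rewrite /prod_pairing pairing0r mulr0 addr0.
have [x [xs]] := maximally_monotone_nonempty maxT.
rewrite {1}TA => -[[zs mu] [[l _ Axl] [_ /= m1]] _]; rewrite m1 in Axl.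
have fNoo y : affine_envelope A y != -oo%E.
  rewrite gt_eqF//; apply: lt_le_trans (affine_envelope_ge y Axl).
  exact: ltNyr.
have fprop : proper_efun (affine_envelope A).
  by exists x; rewrite (affine_envelope_eq Amono A0 Axl).
exists (affine_envelope A); split=> //.
- exact: affine_envelope_lsc.
- exact: affine_envelope_convex.
have [_ Tmax] := maxT; apply/esym/Tmax; first exact: subdifferential_monotone.
by rewrite TA => z; exact: partial_op_sub_subdifferential.
Qed.
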